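(* Let $N\ge 3$ and let $k\in\{1,\dots,N\}$ be such that the $k$-closed-path $[k],[2k],\dots,[Nk],[k]$ is a Hamiltonian cycle $C_k$ (a $k$-Hamiltonian cycle) of the interaction graph on $\{1,\dots,N\}$. Then $\phi(C_k)=\Lambda^{k}-(\Lambda^{k})^{t}$.
   Context: $[i]$ denotes the residue of $i$ modulo $N$, with representative taken in $\{1,\dots,N\}$. The interaction graph is the digraph with vertex set $\{1,\dots,N\}$ and edge set $E=\{(i,j):i<j\}$; closed paths may traverse edges in either direction. A closed path is Hamiltonian if it visits each vertex exactly once (apart from returning to the start). Edges are ordered lexicographically through the bijection $\theta:E\to\{1,\dots,\binom N2\}$, $\theta(i,j)=(i-1)\left(N-\frac i2\right)+j-i$. A cycle $C$ is identified with the vector $C\in\mathbb{R}^{\binom N2}$ whose coordinate $C(\theta(i,j))$, $i<j$, is $1$ if the cycle traverses the edge from $i$ to $j$, $-1$ if it traverses it from $j$ to $i$, and $0$ if it does not use the edge. The map $\phi$ sends such a vector $C$ to the antisymmetric $N\times N$ matrix $M$ with $M_{i,j}=C(\theta(i,j))$ if $i<j$, $M_{i,j}=-C(\theta(j,i))$ if $i>j$, and $M_{i,i}=0$. $\Lambda=\operatorname{circ}(0,1,0,\dots,0)$ is the $N\times N$ matrix with $\Lambda_{ij}=1$ if $j=[i+1]$ and $0$ otherwise. *)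

(* Defs.v *)
From HB Require Import structures.
From mathcomp Require Import all_boot all_order all_algebra.
From mathcomp Require Import zify ring lra.
From mathcomp Require Import reals.
Set Implicit Arguments.
Unset Strict Implicit.
Unset Printing Implicit Defensive.
Import Order.TTheory GRing.Theory Num.Theory.

(* Vertices are the labels 1, ..., N in nat; row or column i : 'I_N of a matrix
   carries the label i.+1. *)

(* The residue of i modulo N with representative in {1, ..., N} (for N > 0). *)
Definition residue (N i : nat) : nat := ((i + N.-1) %% N).+1.

Lemma residue_spec (N i : nat) : 0 < N ->
  1 <= residue N i <= N /\ residue N i = i %[mod N].
Proof.
move=> N_gt0; split; first by rewrite /= ltn_mod.
by rewrite /residue -addn1 modnDml -addnA addn1 prednK // modnDr.
Qed.

Definition is_edge (N i j : nat) : bool := [&& 1 <= i, i < j & j <= N].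

Definition adjacent (N : nat) : rel nat :=
  [rel i j | is_edge N i j || is_edge N j i].

(* As in path.cycle, the sequence [:: v_1; ...; v_m] stands for the closed path
   v_1, ..., v_m, v_1: the return to the start is implicit. *)
Definition hamiltonian_cycle (N : nat) (c : seq nat) : Prop :=
  cycle (adjacent N) c /\ forall v, 1 <= v <= N -> count_mem v c = 1.

Definition k_closed_path (N k : nat) : seq nat :=
  [seq residue N (m * k) | m <- iota 1 N].

(* One step of the closed path c, including the step back to the start, goes
   from i to j. *)
Definition traverses (c : seq nat) (i j : nat) : bool :=
  (i, j) \in zip c (rot 1 c).

Definition edge (N : nat) := {e : 'I_N * 'I_N | e.1 < e.2}.

(* (i - 1) (N - i / 2) + j - i; the product (i - 1) (2 N - i) is even. *)
Definition theta_label (N i j : nat) : nat :=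
  ((i - 1) * (2 * N - i)) %/ 2 + (j - i).

Lemma theta_label2 (N i j : nat) : is_edge N i j ->
  2 * theta_label N i j = (i - 1) * (2 * N - i) + 2 * (j - i).
Proof.
move=> /and3P[i_gt0 ij jN]; rewrite /theta_label mulnDr; congr (_ + _).
rewrite mulnC divnK // dvdn2 oddM oddB // oddB; last by lia.
by rewrite oddM /=; case: (odd i).
Qed.

Lemma theta_label_rat (N i j : nat) : is_edge N i j ->
  ((theta_label N i j)%:R =
     (i%:R - 1) * (N%:R - i%:R / 2%:R) + j%:R - i%:R :> rat)%R.
Proof.
move=> E; have := congr1 (fun n => n%:R%R : rat) (theta_label2 E).
move: E => /and3P[i_gt0 ij jN].
rewrite /= natrD !natrM !natrB ?natrM; try lia.
by move=> H; lra.
Qed.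

Lemma theta_label_range (N i j : nat) : is_edge N i j ->
  1 <= theta_label N i j <= 'C(N, 2).
Proof.
move=> E; have := theta_label2 E; move: E => /and3P[i_gt0 ij jN].
have : 2 * 'C(N, 2) = N * N.-1 by have := mul_bin_diag N 1; rewrite bin1; lia.
have [a Ea] : exists a, i = a.+1 by exists i.-1; lia.
have [b Eb] : exists b, j = a + b + 2 by exists (j - a - 2); lia.
have [d Ed] : exists d, N = a + b + d + 2 by exists (N - j); lia.
have -> : i - 1 = a by lia.
have -> : 2 * N - i = a + 2 * b + 2 * d + 3 by lia.
have -> : j - i = b.+1 by lia.
have -> : N.-1 = a + b + d + 1 by lia.
rewrite [in N * _]Ed => H1 H2; nia.
Qed.

Lemma theta_label_lex (N i j i' j' : nat) :
  is_edge N i j -> is_edge N i' j' -> i < i' ->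
  theta_label N i j < theta_label N i' j'.
Proof.
move=> E E'; have := theta_label2 E'; have := theta_label2 E.
move: E E' => /and3P[i_gt0 ij jN] /and3P[i'_gt0 ij' jN'] H H' ii'.
have [a Ea] : exists a, i = a.+1 by exists i.-1; lia.
have [c Ec] : exists c, i' = a + c + 2 by exists (i' - a - 2); lia.
have [m Em] : exists m, N = a + c + m + 3 by exists (N - i' - 1); lia.
have e1 : i - 1 = a by lia.
have e2 : 2 * N - i = a + 2 * c + 2 * m + 5 by lia.
have e3 : i' - 1 = a + c + 1 by lia.
have e4 : 2 * N - i' = a + c + 2 * m + 4 by lia.
have le1 : j - i <= c + m + 2 by lia.
have le2 : 1 <= j' - i' by lia.
by move: H H'; rewrite e1 e2 e3 e4 => H H'; nia.
Qed.

Lemma edge_is_edge (N : nat) (e : edge N) :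
  is_edge N (val e).1.+1 (val e).2.+1.
Proof. by case: e => -[i j] /= ij; rewrite /is_edge /= ltnS ij ltn_ord. Qed.

Lemma theta_subproof (N : nat) (e : edge N) :
  (theta_label N (val e).1.+1 (val e).2.+1).-1 < 'C(N, 2).
Proof. by have /theta_label_range := edge_is_edge e; lia. Qed.

(* The coordinate t : 'I_'C(N, 2) carries the label t.+1. *)
Definition theta (N : nat) (e : edge N) : 'I_'C(N, 2) :=
  Ordinal (theta_subproof e).

Lemma theta_inj (N : nat) : injective (@theta N).
Proof.
move=> e e' /(congr1 val) /= h.
have E := edge_is_edge e; have E' := edge_is_edge e'.
have heq : theta_label N (val e).1.+1 (val e).2.+1 =
           theta_label N (val e').1.+1 (val e').2.+1.
  have /andP[p _] := theta_label_range E.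
  have /andP[p' _] := theta_label_range E'.
  by rewrite -(prednK p) -(prednK p') h.
apply: val_inj; move: heq E E'.
case: (val e) (val e') => [i j] [i' j'] /= heq E E'.
have /= := theta_label_lex E E'; have /= := theta_label_lex E' E.
rewrite heq ltnn => h1 h2.
have ii' : i = i' by apply: val_inj => /=; lia.
subst i'; congr pair; apply: val_inj => /=.
by move: heq E E'; rewrite /theta_label /is_edge; lia.
Qed.

Lemma card_edge (N : nat) : #|{: edge N}| = 'C(N, 2).
Proof.
rewrite card_sig -sum1_card -bin2_sum big_mkord.
rewrite (eq_bigr (fun j : 'I_N => \sum_(i < N | i < j) 1)); last first.
  move=> j _; rewrite sum1_card -[in LHS](card_ord j).
  have jN := ltnW (ltn_ord j).
  rewrite -(card_image (f := widen_ord jN)); last first.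
    by move=> x y /(congr1 val) /= /val_inj.
  apply: eq_card => i; apply/imageP/idP.
    by move=> [x _ ->]; rewrite unfold_in /=; exact: ltn_ord.
  by rewrite unfold_in /= => ij; exists (Ordinal ij) => //; apply: val_inj.
rewrite (exchange_big_dep xpredT) //= pair_big_dep /=.
by apply: eq_bigl => -[i j].
Qed.

Lemma theta_onto (N : nat) (t : 'I_'C(N, 2)) : t \in codom (@theta N).
Proof. by apply: inj_card_onto; [exact: theta_inj | rewrite card_edge card_ord]. Qed.

Definition theta_inv (N : nat) (t : 'I_'C(N, 2)) : edge N := iinv (theta_onto t).

Lemma thetaK (N : nat) : cancel (@theta N) (@theta_inv N).
Proof. by move=> e; apply: iinv_f; exact: theta_inj. Qed.

Lemma theta_invK (N : nat) : cancel (@theta_inv N) (@theta N).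
Proof. by move=> t; apply: f_iinv. Qed.

Local Open Scope ring_scope.

Definition edge_sign (R : realType) (c : seq nat) (i j : nat) : R :=
  if traverses c i j then 1 else if traverses c j i then -1 else 0.

Definition cycle_vector (R : realType) (N : nat) (c : seq nat) :
    'rV[R]_'C(N, 2) :=
  \row_t let e := val (theta_inv t) in edge_sign R c e.1.+1 e.2.+1.

Lemma cycle_vectorE (R : realType) (N : nat) (c : seq nat) (e : edge N) :
  cycle_vector R N c 0 (theta e) = edge_sign R c (val e).1.+1 (val e).2.+1.
Proof. by rewrite mxE thetaK. Qed.

(* insub (i, j) is Some edge exactly when i < j. *)
Definition phi (R : realType) (N : nat) (C : 'rV[R]_'C(N, 2)) : 'M[R]_N :=
  \matrix_(i, j)
    if (insub (i, j) : option (edge N)) is Some e then C 0 (theta e)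
    else if (insub (j, i) : option (edge N)) is Some e then - C 0 (theta e)
    else 0.

Definition Lambda (R : realType) (N : nat) : 'M[R]_N :=
  \matrix_(i, j) if j.+1 == residue N i.+2 then 1 else 0.

(* Main.v *)
(* Both sides only see the successor relation of the walk m |-> [m k]: as every
   vertex is some [m k], the walk goes from i to j exactly when j = [i + k], and
   that is also when the (i, j) entry of Lambda^k is 1. An entry could only be
   counted in both directions if [k] = [3 k], which a Hamiltonian cycle with
   N >= 3 vertices excludes. *)
Require Import Defs.
From mathcomp Require Import all_boot all_order all_algebra.
From mathcomp Require Import reals.
Import GRing.Theory.
Local Open Scope ring_scope.

Lemma residueS (N n : nat) : (0 < N)%N -> residue N n.+1 = (n %% N).+1.
Proof. by move=> N_gt0; rewrite /residue addSnnS prednK // modnDr. Qed.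

Lemma eq_residue (N a b : nat) :
  a = b %[mod N] -> residue N a = residue N b.
Proof. by move=> ab; rewrite /residue -modnDml ab modnDml. Qed.

Lemma residueDml (N a b : nat) :
  (0 < N)%N -> residue N (residue N a + b) = residue N (a + b).
Proof.
move=> N_gt0; apply: eq_residue.
by have [_ e] := residue_spec a N_gt0; rewrite -modnDml e modnDml.
Qed.

(** [Lambda] is the permutation matrix of the cyclic shift, so in each sum for
    [Lambda ^+ k * Lambda] only the column [l] reached from [i] after [k] shifts survives. *)
Lemma Lambda_exp (R : realType) (N k : nat) (i j : 'I_N) :
  (Lambda R N ^+ k) i j = (j == (i + k) %% N :> nat)%N%:R.
Proof.
have N_gt0 : (0 < N)%N by apply: leq_ltn_trans (ltn_ord i).
elim: k j => [|k IHk] j.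
  by rewrite expr0 mxE addn0 modn_small // eq_sym.
pose l := Ordinal (ltn_pmod (i + k) N_gt0).
rewrite exprSr mxE (bigD1 l) //= big1 ?addr0 => [|m ml].
  rewrite IHk eqxx mul1r mxE residueS //= eqSS -addn1 modnDml addn1 -addnS.
  by case: eqP.
by rewrite IHk; case: eqP => [e|_]; rewrite ?mul0r //; case/eqP: ml; apply: val_inj.
Qed.

(** The return to the start needs no special case: modulo [N], [N.+1 * k] equals [k], so it is one
    more step of the walk. *)
Lemma rot1_k_closed_path (N k : nat) : (0 < N)%N ->
  rot 1 (k_closed_path N k) = [seq residue N (m.+1 * k) | m <- iota 1 N].
Proof.
case: N => // N _; rewrite /k_closed_path.
have -> : [seq residue N.+1 (m.+1 * k) | m <- iota 1 N.+1] =
    [seq residue N.+1 (m * k) | m <- iota (1 + 1) N.+1].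
  by rewrite iotaDl -map_comp.
have -> : iota (1 + 1) N.+1 = rcons (iota 2 N) N.+2.
  by rewrite -[in LHS](addn1 N) iotaD cats1.
rewrite -map_rot -[iota 1 N.+1]/(1%N :: iota 2 N) rot1_cons !map_rcons.
congr rcons; apply: eq_residue.
by rewrite mul1n mulSn -modnDmr modnMr addn0.
Qed.

Lemma traverses_k_closed_path (N k : nat) (i j : 'I_N) :
  hamiltonian_cycle N (k_closed_path N k) ->
  traverses (k_closed_path N k) i.+1 j.+1 = (j == (i + k) %% N :> nat)%N.
Proof.
have N_gt0 : (0 < N)%N by apply: leq_ltn_trans (ltn_ord i).
move=> [_ hC]; rewrite /traverses rot1_k_closed_path // zip_map.
(* Pass from indices to labels: the condition becomes [j.+1 = residue N (i.+1 + k)]. *)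
rewrite -[RHS]eqSS -residueS // -addSn.
apply/mapP/eqP => [[m _ [-> ->]]|jE].
  by rewrite residueDml // -mulSnr.
(* The Hamiltonian property provides a time [m] at which the walk is at [i.+1]. *)
have /mapP[m mN iE] : i.+1 \in k_closed_path N k.
  by rewrite -has_pred1 has_count hC //= ltn_ord.
by exists m; rewrite // -iE jE iE residueDml // -mulSnr.
Qed.

(** [hamiltonian_cycle] counts only the labels from 1 to [N]; residues take no other value. *)
Lemma hamiltonian_uniq (N k : nat) : (0 < N)%N ->
  hamiltonian_cycle N (k_closed_path N k) -> uniq (k_closed_path N k).
Proof.
move=> N_gt0 [_ hC]; apply: count_mem_uniq => v.
have [vc|/count_memPn ->//] := boolP (v \in _).
have /mapP[m _ vE] := vc.
by apply: hC; rewrite vE; case: (residue_spec (m * k) N_gt0).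
Qed.

Lemma k_closed_path_asym (N k i j : nat) : (3 <= N)%N ->
  hamiltonian_cycle N (k_closed_path N k) ->
  j = ((i + k) %% N)%N -> i = ((j + k) %% N)%N -> False.
Proof.
move=> hN hC -> iE; have N_gt0 : (0 < N)%N by apply: leq_trans hN.
have k2 : (k + k = 0 %[mod N])%N.
  apply/eqP; rewrite -(eqn_modDl i) addn0 addnA -[X in X == _]modnDml.
  by rewrite [in X in _ == X]iE modn_mod.
have k13 : residue N (1 * k) = residue N (3 * k).
  by apply: eq_residue; rewrite !mulSn mul0n !addn0 -modnDmr k2 modnDmr addn0.
have := hamiltonian_uniq N k N_gt0 hC.
(* Isolate the first three vertices, where [k13] makes the first and third coincide. *)
rewrite /k_closed_path -(subnKC hN) iotaD map_cat cat_uniq => /andP[+ _].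
by rewrite subnKC //= k13 !inE eqxx orbT.
Qed.

Theorem proposition2 (R : realType) (N k : nat)
    (hN : (3 <= N)%N) (hk : (1 <= k <= N)%N)
    (hC : hamiltonian_cycle N (k_closed_path N k)) :
  phi (cycle_vector R N (k_closed_path N k)) =
  Lambda R N ^+ k - (Lambda R N ^+ k)^T.
Proof.
have signE (i j : 'I_N) : edge_sign R (k_closed_path N k) i.+1 j.+1 =
    (Lambda R N ^+ k) i j - (Lambda R N ^+ k) j i.
  rewrite /edge_sign !traverses_k_closed_path // !Lambda_exp.
  case: eqP => [ji|_]; case: eqP => [ij|_] /=; rewrite ?subr0 ?sub0r //.
  (* Both directions at once: the sign would be 1 but the matrix difference 0. *)
  by case: (k_closed_path_asym N k i j).
apply/matrixP => i j; rewrite !mxE.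
case: insubP => [e _ eE|ij]; first by rewrite cycle_vectorE eE signE.
case: insubP => [e _ eE|ji]; first by rewrite cycle_vectorE eE signE opprB.
(* Neither pair is an edge, so the entry is diagonal and [phi] gives 0. *)
move: ij ji; rewrite /= -!leqNgt => ji ij.
have -> : i = j by apply/ord_inj/anti_leq; rewrite ij ji.
by rewrite subrr.
Qed.
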